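(* Let $I\subseteq\mathbb R$ be an open interval, $(X,d)$ a proper geodesic length space, $f:I\to(0,\infty)$ continuous, and let $(I\times_fX,D,\le,\ll,\tau)$ be the corresponding Lorentzian warped product. Let $N\ge0$. Then $\mathcal W^N$ coincides with $\mathcal V^N$ (as Borel measures on $I\times_f X$), where $\mathcal W^N$ and $\mathcal V^N$ are taken with respect to the product metric $D$.
   Context: Lorentzian warped product $Y=I\times_fX$: the set $I\times X$ with the product metric $D((t,x),(s,y))=\sqrt{|t-s|^2+d(x,y)^2}$. Consider curves $\gamma=(\alpha,\beta):[a,b]\to Y$ with $\alpha,\beta$ absolutely continuous and $\alpha$ strictly monotone; let $v_\beta$ denote the metric derivative of $\beta$. Such $\gamma$ is timelike (causal) if $-\dot\alpha^2+(f\circ\alpha)^2v_\beta^2<0$ (resp. $\le0$) almost everywhere, and future-directed if $\alpha$ is strictly increasing. Its length is $L(\gamma)=\int_a^b\sqrt{\dot\alpha^2-(f\circ\alpha)^2v_\beta^2}\,dt$. Then $x\le y$ iff $x=y$ or there is a future-directed causal curve from $x$ to $y$; $x\ll y$ iff there is a future-directed timelike curve from $x$ to $y$; $\tau(x,y)=\sup\{L(\gamma)\mid\gamma\text{ future-directed causal from }x\text{ to }y\}$ (and $0$ if there is none). $x<y$ means $x\le y$, $x\ne y$. $J(p,q)=\{z\mid p\le z\le q\}$, $\mathcal J:=\{J(p,q)\mid p<q\}\cup\{\emptyset\}$, $\rho_N(J(p,q)):=\omega_N\tau(p,q)^N$ ($\infty$ if $\tau(p,q)=\infty$), $\rho_N(\emptyset):=0$,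 with $\omega_N=\frac{\pi^{(N-1)/2}}{N\,\Gamma((N+1)/2)\,2^{N-1}}$ for $N>0$, and for $N=0$, $\omega_0$ a fixed positive constant with $0^0=1$. For $A\subseteq Y$ and $\delta>0$, $$\mathcal V^N_{\delta}(A):=\inf\Big\{\sum_{i=1}^\infty\rho_N(A_i)\ \Big|\ A_i\in\mathcal J,\ \mathrm{diam}_D(A_i)<\delta,\ A\subseteq\bigcup_i A_i\Big\},$$ $$\mathcal W^N_{\delta}(A):=\inf\Big\{\sum_{i=1}^\infty\rho_N(J(a_i,b_i))\ \Big|\ J(a_i,b_i)\in\mathcal J,\ D(a_i,b_i)<\delta,\ A\subseteq\bigcup_i J(a_i,b_i)\Big\},$$ with $\inf\emptyset=\infty$ (members of the cover in the second definition may also be empty, with weight $0$), and $\mathcal V^N(A):=\sup_{\delta>0}\mathcal V^N_\delta(A)$, $\mathcal W^N(A):=\sup_{\delta>0}\mathcal W^N_\delta(A)$. *)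

(* Defs.v *)
From HB Require Import structures.
From mathcomp Require Import all_boot all_order all_algebra.
From mathcomp Require Import all_classical all_reals all_analysis.

Set Implicit Arguments.
Unset Strict Implicit.
Unset Printing Implicit Defensive.

Import Order.TTheory GRing.Theory Num.Theory.
Import numFieldTopology.Exports numFieldNormedType.Exports.

Local Open Scope classical_set_scope.
Local Open Scope ring_scope.

Section metric_space.
Context {R : realType}.

Definition curve_length (X : metricType R) (c : R -> X) (a b : R) : \bar R :=
  ereal_sup [set (\sum_(0 <= i < size s)
      mdist (c (nth b (a :: s) i)) (c (nth b (a :: s) i.+1)))%:E
    | s in itv_partition a b].

Definition paths (X : metricType R) (x y : X) : set (R -> X) :=
  [set c : R -> X | [/\ {within `[0 : R, 1], continuous c}, c 0 = x & c 1 = y]].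

Definition length_space (X : metricType R) : Prop :=
  forall x y : X,
    (mdist x y)%:E = ereal_inf [set curve_length c 0 1 | c in paths x y].

Definition geodesic_space (X : metricType R) : Prop :=
  forall x y : X, exists2 c, paths x y c & curve_length c 0 1 = (mdist x y)%:E.

Definition proper_space (X : metricType R) : Prop :=
  forall (x : X) (r : R), compact [set y | mdist x y <= r].

Definition abs_continuous (X : metricType R) (a b : R) (c : R -> X) : Prop :=
  forall e : R, 0 < e -> exists2 d : R, 0 < d &
    forall (n : nat) (s u : 'I_n -> R),
      (forall i, a <= s i /\ s i <= u i /\ u i <= b) ->
      trivIset setT (fun i => `]s i, u i[%classic) ->
      \sum_(i < n) (u i - s i) < d ->
      \sum_(i < n) mdist (c (s i)) (c (u i)) < e.

Definition metric_quotient (X : metricType R) (c : R -> X) (t h : R) : R :=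
  mdist (c (t + h)) (c t) / `|h|.

(* Meaningful only where the limit exists. *)
Definition metric_derivative (X : metricType R) (c : R -> X) (t : R) : R :=
  lim (metric_quotient c t h @[h --> 0^']).

End metric_space.

(* The warped product I x_f X is the subset I x X of R * X.  As I is open, its
   Borel sets, for the topology of the metric D, are those generated by the
   open sets of R * X contained in it. *)
Section warped_product.
Context {R : realType} (X : metricType R) (I : set R) (f : R -> R).

Definition warped : set (R * X) := [set p | I p.1].

Definition Borel : set (set (R * X)) :=
  <<s warped, [set U | open U /\ U `<=` warped] >>.

Definition Borel_measure (m : set (R * X) -> \bar R) : Prop :=
  [/\ m set0 = 0%E,
      (forall A, Borel A -> (0 <= m A)%E) &
      forall F : nat -> set (R * X),
        (forall i, Borel (F i)) -> trivIset setT F ->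
        m (\bigcup_i F i) = (\sum_(0 <= i <oo) m (F i))%E].

Definition wdist (p q : R * X) : R :=
  Num.sqrt (`|p.1 - q.1| ^+ 2 + mdist p.2 q.2 ^+ 2).

(* -oo on the empty set *)
Definition wdiam (A : set (R * X)) : \bar R :=
  ereal_sup [set (wdist p q)%:E | p in A & q in A].

(* The derivative of alpha and the metric derivative of beta exist almost
   everywhere by absolute continuity; the almost-everywhere condition only
   concerns points where they do. *)
Definition causal_at (alpha : R -> R) (beta : R -> X) (t : R) : Prop :=
  [/\ derivable alpha t 1, cvg (metric_quotient beta t h @[h --> 0^']) &
      - derive1 alpha t ^+ 2 + f (alpha t) ^+ 2 * metric_derivative beta t ^+ 2
        <= 0].

(* The nondegeneracy a < b matters for p = q: there is no curve from p to p. *)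
Definition future_causal_curve (p q : R * X) (a b : R)
    (alpha : R -> R) (beta : R -> X) : Prop :=
  [/\ a < b,
      (alpha a, beta a) = p /\ (alpha b, beta b) = q,
      (forall t, t \in `[a, b] -> I (alpha t)),
      {in `[a, b] &, {homo alpha : s t / s < t}} &
      [/\ abs_continuous a b (alpha : R -> R^o), abs_continuous a b beta &
          {ae lebesgue_measure, forall t, t \in `[a, b] ->
             causal_at alpha beta t}]].

Definition lorentz_length (a b : R) (alpha : R -> R) (beta : R -> X) :
    \bar R :=
  (\int[lebesgue_measure]_(t in `[a, b])
    (Num.sqrt (derive1 alpha t ^+ 2
       - f (alpha t) ^+ 2 * metric_derivative beta t ^+ 2))%:E)%E.

Definition causal_le (p q : R * X) : Prop :=
  (warped p /\ p = q) \/
  exists a b alpha beta, future_causal_curve p q a b alpha beta.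

Definition causal_lt (p q : R * X) : Prop := causal_le p q /\ p <> q.

Definition curve_lengths (p q : R * X) : set (\bar R) :=
  [set L | exists a b alpha beta,
     future_causal_curve p q a b alpha beta /\
     L = lorentz_length a b alpha beta].

Definition time_separation (p q : R * X) : \bar R :=
  if `[< curve_lengths p q !=set0 >] then ereal_sup (curve_lengths p q)
  else 0%E.

Definition diamond (p q : R * X) : set (R * X) :=
  [set z | causal_le p z /\ causal_le z q].

Definition diamonds : set (set (R * X)) :=
  [set A | A = set0 \/ exists p q, causal_lt p q /\ A = diamond p q].

End warped_product.

Section measures.
Context {R : realType}.

Definition Gamma (s : R) : R :=
  Rintegral lebesgue_measure `]0, +oo[%classic
    (fun t => t `^ (s - 1) * expR (- t)).

Definition omega (w0 N : R) : R :=
  if N == 0 then w0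
  else pi `^ ((N - 1) / 2) / (N * Gamma ((N + 1) / 2) * 2 `^ (N - 1)).

Context (X : metricType R) (I : set R) (f : R -> R) (w0 N : R).

Definition weight (p q : R * X) : \bar R :=
  let tau := time_separation I f p q in
  if tau == +oo%E then +oo%E else ((omega w0 N)%:E * poweR tau N)%E.

(* The endpoints p < q of a diamond are its least and its greatest element, so
   that the infimum is over a single value for A in [diamonds I f]. *)
Definition rho (A : set (R * X)) : \bar R :=
  ereal_inf [set w | (A = set0 /\ w = 0%E) \/
    exists p q, [/\ causal_lt I f p q, A = diamond I f p q & w = weight p q]].

Definition cover_inf (C : set (set (R * X))) (A : set (R * X)) : \bar R :=
  ereal_inf [set (\sum_(0 <= i <oo) rho (F i))%E
    | F in [set F : nat -> set (R * X) |
        (forall i, C (F i)) /\ A `<=` \bigcup_i F i]].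

Definition Vdelta (d : R) : set (R * X) -> \bar R :=
  cover_inf [set A | diamonds I f A /\ (wdiam A < d%:E)%E].

Definition Wdelta (d : R) : set (R * X) -> \bar R :=
  cover_inf [set A | A = set0 \/ exists p q,
    [/\ causal_lt I f p q, wdist p q < d & A = diamond I f p q]].

Definition Vmeas (A : set (R * X)) : \bar R :=
  ereal_sup [set Vdelta d A | d in [set d : R | 0 < d]].

Definition Wmeas (A : set (R * X)) : \bar R :=
  ereal_sup [set Wdelta d A | d in [set d : R | 0 < d]].

End measures.

(* Main.v *)
(** Both [Vmeas] and [Wmeas] are suprema over d of outer measures obtained from
covers.  The members of a cover for [Vmeas] have diameter < d, so [Vmeas] is a
metric outer measure and Caratheodory's criterion makes Borel sets measurable.
As p and q belong to J(p, q), every cover for [Vmeas] is a cover for [Wmeas],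
whence W <= V.  Conversely, d(beta(s), beta(t)) <= (alpha(t) - alpha(s)) / r
along a causal curve on which f o alpha >= r, so that a diamond J(p, q) has
diameter at most (1 + 2/r) D(p, q) where f >= r.  This gives V <= W on each set
of an increasing sequence of measurable sets that exhausts the warped product,
and continuity of V along this sequence concludes; that W is a measure on Borel
sets is then inherited from V. *)
Require Import Defs.
From HB Require Import structures.
From mathcomp Require Import all_boot all_order all_algebra.
From mathcomp Require Import all_classical all_reals all_analysis.
From mathcomp Require Import measurable_realfun lra.

Set Implicit Arguments.
Unset Strict Implicit.
Unset Printing Implicit Defensive.

Import Order.TTheory GRing.Theory Num.Theory.
Import numFieldTopology.Exports numFieldNormedType.Exports.

Local Open Scope classical_set_scope.
Local Open Scope ring_scope.

(** * Outer measures from covers, and Caratheodory's criterion *)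

Section cover_ext.
Local Open Scope ereal_scope.
Context {R : realType} {T : Type} (C : set (set T)) (w : set T -> \bar R).
Hypotheses (C0 : C set0) (w0 : w set0 = 0) (w_ge0 : forall A, 0 <= w A).

(** An abstract form of [cover_inf]: [Vdelta] and [Wdelta] are convertible to instances of it. *)
Definition cover_ext (A : set T) : \bar R :=
  ereal_inf [set \sum_(0 <= i <oo) w (F i)
    | F in [set F : nat -> set T |
        (forall i, C (F i)) /\ A `<=` \bigcup_i F i]].

Lemma cover_ext_ge0 A : 0 <= cover_ext A.
Proof.
by apply: le_ereal_inf_tmp => _ [F _ <-]; apply: nneseries_ge0.
Qed.

Lemma cover_ext0 : cover_ext set0 = 0.
Proof.
apply/eqP; rewrite eq_le cover_ext_ge0 andbT.
apply: ereal_inf_lbound; exists (fun=> set0); first by split.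
by rewrite eseries0.
Qed.

Lemma le_cover_ext A B : A `<=` B -> cover_ext A <= cover_ext B.
Proof.
move=> AB; apply: ereal_inf_le_tmp => _ [F [CF BF] <-].
by exists F => //; split => //; apply: subset_trans BF.
Qed.

(** Near-optimal covers of the sets [A n], with errors e / 2^(n+1), are merged into one cover along
    a bijection from [nat] to [nat * nat]. *)
Lemma cover_ext_sigma_subadditive : sigma_subadditive cover_ext.
Proof.
move=> A; have [[i Ai]|Afin] := pselect (exists i, cover_ext (A i) = +oo).
  by rewrite (nneseries_pinfty _ _ Ai) ?leey// => n _; exact: cover_ext_ge0.
apply/lee_addgt0Pr => e e0.
apply: le_trans (epsilon_trick xpredT _ (ltW e0)); last first.
  by move=> n; exact: cover_ext_ge0.
have [G PG] : {G : nat -> nat -> set T & forall n,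
    [/\ forall i, C (G n i), A n `<=` \bigcup_i G n i &
      \sum_(0 <= i <oo) w (G n i) <=
        cover_ext (A n) + (e / (2 ^ n.+1)%:R)%:E]}.
  apply: (@choice _ _ (fun n F =>
    [/\ forall i, C (F i), A n `<=` \bigcup_i F i &
      \sum_(0 <= i <oo) w (F i) <= cover_ext (A n) + (e / (2 ^ n.+1)%:R)%:E])).
  move=> n; have en : (0 < e / (2 ^ n.+1)%:R)%R.
    by rewrite divr_gt0// ltr0n expn_gt0.
  have finA : cover_ext (A n) \is a fin_num.
    rewrite ge0_fin_numE ?cover_ext_ge0// ltey.
    by apply/eqP => An; apply: Afin; exists n.
  have [_ [F [CF AF] <-] Fe] := lb_ereal_inf_adherent en finA.
  by exists F; split => //; exact: ltW.
have /card_esym/ppcard_eqP[h] := card_nat2.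
pose F i := G (h i).1 (h i).2.
apply: (@le_trans _ _ (\sum_(0 <= i <oo) w (F i))).
  apply: ereal_inf_lbound; exists F => //; split.
    by move=> i; have [CG _ _] := PG (h i).1; exact: CG.
  move=> x [n _ Anx]; have [_ AG _] := PG n; have [k _ Gx] := AG _ Anx.
  by exists (h^-1%FUN (n, k)) => //; rewrite /F invK ?inE.
rewrite nneseries_esumT//.
have <- := reindex_esum [set: nat] [set: nat * nat] h
  (fun k => w (G k.1 k.2)) bij.
rewrite [X in esum X _](_ : _ = [set: nat] `*`` (fun=> [set: nat]));
  last exact/seteqP.
rewrite -(@esum_esum _ _ _ _ _ (fun n i => w (G n i)))//.
rewrite nneseries_esumT; last first.
  by move=> n; rewrite adde_ge0 ?cover_ext_ge0// lee_fin divr_ge0// ltW.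
apply: le_esum => n _; have [_ _ Gn] := PG n.
by rewrite -nneseries_esumT.
Qed.

End cover_ext.

Section metric_outer_measure.
Local Open Scope ereal_scope.
Context {R : realType} {T : Type} (dist : T -> T -> R).
Variable mu : {outer_measure set T -> \bar R}.
Hypothesis dist_triangle : forall y x z, (dist x z <= dist x y + dist y z)%R.
Hypothesis mu_metric : forall (e : R) (A B : set T), (0 < e)%R ->
  (forall x y, A x -> B y -> (e <= dist x y)%R) -> mu A + mu B <= mu (A `|` B).

(* [A n] collects the points of X at distance at least 1/(n+1) from the
   complement of U.  As [A n] and the layer [B n.+1] are apart, the measures of
   the layers telescope, hence mu (X `&` U) is the supremum of mu (A n). *)
Lemma metric_outer_caratheodory (U : set T) :
  (forall x, U x -> exists2 e : R, (0 < e)%R &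
    forall y, (dist x y < e)%R -> U y) ->
  mu.-caratheodory U.
Proof.
move=> openU; apply: le_caratheodory_measurable => X.
have [->|Xoo] := eqVneq (mu X) +oo; first exact: leey.
have Xfin : mu X < +oo by rewrite ltey.
pose A n := [set x | [/\ X x, U x &
  forall y, ~ U y -> (n.+1%:R^-1 <= dist x y)%R]].
have AX n : A n `<=` X by move=> x [].
have Afin n : mu (A n) \is a fin_num.
  rewrite ge0_fin_numE ?outer_measure_ge0//.
  exact: le_lt_trans (le_outer_measure mu _ _ (AX n)) Xfin.
have inv_lt n : (n.+2%:R^-1 < n.+1%:R^-1 :> R)%R.
  by rewrite ltf_pV2 ?posrE// ltr_nat.
have AS n : A n `<=` A n.+1.
  move=> x [Xx Ux Ax]; split => // y /Ax; apply: le_trans; exact: ltW.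
have leA n m : (n <= m)%N -> A n `<=` A m.
  move=> /subnK <-; elim: (m - n)%N => // k IH.
  exact: subset_trans IH (AS _).
pose B n := A n.+1 `\` A n.
have AB n : mu (A n) + mu (B n.+1) <= mu (A n.+2).
  apply: (@le_trans _ _ (mu (A n `|` B n.+1))); last first.
    apply: le_outer_measure => x [/(leA n n.+2)|[]//]; apply.
    by rewrite (leq_trans (leqnSn _)).
  (* A point of [B n.+1] is outside [A n.+1], hence less than 1/(n+2) away from the complement of
     [U], whereas points of [A n] keep distance 1/(n+1) from it. *)
  apply: (mu_metric (e := n.+1%:R^-1 - n.+2%:R^-1)); first by rewrite subr_gt0.
  move=> x z [_ _ Ax] [[Xz Uz _] nAz].
  have [y [nUy zy]] : exists y, ~ U y /\ (dist z y < n.+2%:R^-1)%R.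
    apply: contrapT => /forallNP nex; apply: nAz; split => // y nUy.
    by rewrite leNgt; apply/negP => zy; exact: (nex y).
  rewrite lerBlDr (le_trans (Ax _ nUy))// (le_trans (dist_triangle z _ _))//.
  by rewrite lerD2l ltW.
have AC n : mu (A n) + mu (X `&` ~` U) <= mu X.
  apply: (@le_trans _ _ (mu (A n `|` X `&` ~` U))); last first.
    by apply: le_outer_measure => x [/AX|[]].
  apply: (mu_metric (e := n.+1%:R^-1)); first by rewrite invr_gt0.
  by move=> x y [_ _ Ax] [_ nUy]; exact: Ax.
pose l := ereal_sup (range (mu \o A)).
have Al n : mu (A n) <= l by apply: ereal_sup_ubound; exists n.
have lX : l <= mu X.
  by apply: ge_ereal_sup => _ [n _ <-] /=; exact: le_outer_measure.
have lfin : l \is a fin_num.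
  rewrite ge0_fin_numE; first exact: le_lt_trans Xfin.
  exact: le_trans (outer_measure_ge0 mu (A 0%N)) (Al 0%N).
(* [AB] skips one layer, so the even and the odd layers telescope separately; adding both gives sums
   of two consecutive measures. *)
have sumB n m : \sum_(0 <= k < m) mu (B (k + n.+1)%N) + (mu (A n) + mu (A n.+1))
    <= mu (A (m + n)%N) + mu (A (m + n).+1).
  elim: m => [|m IH]; first by rewrite big_geq// add0e.
  rewrite big_nat_recr//= addeAC addSn addeC.
  rewrite addnS [leRHS]addeC.
  apply: le_trans (leeD2l _ IH) _.
  by rewrite addeA leeD2r// addeC; exact: AB.
have UA n : X `&` U `<=` A n.+1 `|` \bigcup_k B (k + n.+1)%N.
  move=> x [Xx Ux]; have [e e0 Ue] := openU x Ux.
  have [m Am] : exists m, A m x.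
    have [m me] := ltr_add_invr e0; rewrite add0r in me.
    exists m; split => // y nUy; rewrite leNgt; apply/negP => xy.
    by apply: nUy; apply: Ue; apply: lt_trans me.
  have [k Ak] : exists k, A (k + n.+1)%N x.
    by exists m; apply: leA Am; exact: leq_addr.
  elim: k Ak => [|k IH] Ak; first by left; rewrite add0n in Ak.
  have [/IH//|nAk] := pselect (A (k + n.+1)%N x).
  by right; exists k => //; split.
(* By [sumB], the layers outside [A n.+1] add up to at most twice the defect [l - mu (A n)], which
   tends to 0. *)
have muU n : mu (X `&` U) <= mu (A n.+1) + (l - mu (A n) + (l - mu (A n))).
  apply: le_trans (le_outer_measure mu _ _ (UA n)) _.
  apply: le_trans (outer_measureU2 mu _ _) _; apply: leeD2l.
  apply: le_trans (outer_measure_sigma_subadditive mu _) _.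
  apply: lime_le.
    by apply: is_cvg_nneseries => *; exact: outer_measure_ge0.
  apply: nearW => m /=.
  rewrite addeACA -fin_num_oppeD// leeBrDr ?fin_numD ?Afin//.
  apply: (@le_trans _ _ (mu (A (m + n)%N) + mu (A (m + n).+1))); last first.
    exact: leeD.
  apply: le_trans (sumB n m); rewrite leeD2l// leeD2l//.
  by apply: le_outer_measure; exact: AS.
have Ul : mu (X `&` U) <= l.
  apply/lee_addgt0Pr => e e0.
  have e20 : (0 < e / 2)%R by rewrite divr_gt0.
  have [_ [n _ <-] /= An] := ub_ereal_sup_adherent e20 lfin.
  apply: le_trans (muU n) _; apply: leeD => //.
  rewrite [e in leRHS]splitr EFinD.
  by apply: leeD; rewrite leeBlDr// addeC -leeBlDr// ltW.
have Cfin : mu (X `&` ~` U) \is a fin_num.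
  rewrite ge0_fin_numE ?outer_measure_ge0//.
  by apply: le_lt_trans Xfin; exact: le_outer_measure.
rewrite -leeBrDr//; apply: le_trans Ul _; apply: ge_ereal_sup => _ [n _ <-] /=.
by rewrite leeBrDr.
Qed.

End metric_outer_measure.

(** * Speed bound along causal curves *)

Section causal_curves.
Context {R : realType} {X : metricType R}.

(** Causality gives m * v <= |a| for the two derivatives at [t]. Near [t] the difference quotients
    are close to them, and [e] absorbs both errors. *)
Lemma causal_at_local_lipschitz (f alpha : R -> R) (beta : R -> X) (t m e : R) :
  causal_at f alpha beta t -> 0 < m -> m <= f (alpha t) -> 0 < e ->
  exists2 d : R, 0 < d & forall s, `|s - t| < d ->
    mdist (beta s) (beta t) <= m^-1 * `|alpha s - alpha t| + e * `|s - t|.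
Proof.
move=> [dalpha cbeta causal] m0 mf e0.
have e20 : 0 < e / 2 by rewrite divr_gt0.
(* The tolerance for the quotient of [alpha]: division by [m] turns it into e/2, and the quotient of
   [beta] takes the other half. *)
have me0 : 0 < m * (e / 2) by rewrite mulr_gt0.
set v := metric_derivative beta t in causal.
set a := derive1 alpha t in causal.
have v0 : 0 <= v.
  apply: limr_ge; first exact: cbeta.
  by apply: nearW => h; rewrite /metric_quotient divr_ge0// mdist_ge0.
have mva : m * v <= `|a|.
  rewrite -(ger0_norm (mulr_ge0 (ltW m0) v0)) -ler_sqr ?nnegrE//.
  rewrite !real_normK ?num_real// exprMn.
  have : m ^+ 2 * v ^+ 2 <= f (alpha t) ^+ 2 * v ^+ 2.
    rewrite ler_wpM2r ?sqr_ge0// ler_sqr ?nnegrE ?(ltW m0)//.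
    exact: le_trans (ltW m0) mf.
  by move: causal; lra.
have cvga :
    (h^-1 *: ((alpha \o shift t) (h *: 1) - alpha t) : R) @[h --> 0^'] --> a.
  by rewrite /a derive1E; exact: dalpha.
have /cvgrPdist_lt/(_ _ me0) near_a := cvga.
have /cvgrPdist_lt/(_ _ e20) near_v := cbeta : _ --> v.
have [d /= d0 near_av] := proj1 (@nbhs_ballP _ _ (0 : R) _)
  (@filterI _ (0 : R)^' _ _ _ near_a near_v).
exists d => // s std.
have [->|st] := eqVneq s t; first by rewrite mdistxx !subrr normr0 !mulr0 addr0.
have h0 : s - t != 0 by rewrite subr_eq0.
have hn0 : 0 < `|s - t| by rewrite normr_gt0.
have [] := near_av (s - t); rewrite /ball/= ?sub0r ?normrN//.
rewrite /metric_quotient (addrC t) subrK /shift/= scaler1 subrK => Ha Hv.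
have {}Hv : mdist (beta s) (beta t) / `|s - t| < v + e / 2.
  by move: Hv; rewrite ltr_distlC => /andP[_].
have {}Ha : `|a| <= m * (e / 2) + `|alpha s - alpha t| / `|s - t|.
  rewrite -normfV -normrM -lerBlDr [X in _ - `|X|]mulrC.
  exact: le_trans (lerB_dist _ _) (ltW Ha).
rewrite ltr_pdivrMr// in Hv.
have {}Ha : `|a| * `|s - t| <= m * (e / 2) * `|s - t| + `|alpha s - alpha t|.
  by move: (ler_wpM2r (ltW hn0) Ha); rewrite mulrDl divfK ?lt0r_neq0.
have {}mva : m * v * `|s - t| <= `|a| * `|s - t| by rewrite ler_wpM2r// ltW.
rewrite -(ler_pM2l m0) mulrDr mulrA divff ?lt0r_neq0// mul1r.
have : m * mdist (beta s) (beta t) <= m * ((v + e / 2) * `|s - t|).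
  by rewrite ler_wpM2l// ltW.
by move: mva Ha; lra.
Qed.

(* A continuous induction on t: [T] holds at t when the bound holds on [a, t] up
   to e * (t - a) and to the increments of beta over finitely many disjoint
   intervals inside a small open neighborhood U of the exceptional null set.
   Absolute continuity makes the total of those increments small. *)
Lemma mdist_le_of_local_lipschitz (a b C : R) (alpha : R -> R) (beta : R -> X) :
  a <= b -> 0 <= C -> {in `[a, b] &, {homo alpha : s t / s <= t}} ->
  abs_continuous a b beta ->
  {ae lebesgue_measure, forall t, t \in `[a, b] -> forall e : R, 0 < e ->
    exists2 d : R, 0 < d & forall s, `|s - t| < d ->
      mdist (beta s) (beta t) <= C * `|alpha s - alpha t| + e * `|s - t|} ->
  mdist (beta a) (beta b) <= C * (alpha b - alpha a).
Proof.
move=> ab C0 alphaP acb [N [mN N0 subN]].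
apply/ler_addgt0Pl => e0 e0_gt0.
(* The summand 1 keeps the divisor positive when a = b. The other half of [e0] is for the increments
   over intervals in [U]. *)
pose e := e0 / 2 / (b - a + 1).
have ba1 : 0 < b - a + 1 by rewrite ltr_wpDl// subr_ge0.
have e_gt0 : 0 < e by rewrite !divr_gt0.
have e02 : 0 < e0 / 2 by rewrite divr_gt0.
have [del del0 acdel] := acb _ e02.
have [U [oU NU muU]] : exists U : set R,
    [/\ open U, N `<=` U & (lebesgue_measure (U `\` N) < del%:E)%E].
  apply: lebesgue_regularity_outer => //.
  by apply: le_lt_trans (ltry 0); rewrite le_eqVlt; apply/orP; left; exact/eqP.
have mU : measurable U by exact: open_measurable.
have {}muU : (lebesgue_measure U < del%:E)%E.
  have -> : lebesgue_measure U =
      (lebesgue_measure (U `\` N) + lebesgue_measure (U `&` N))%E.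
    exact: measureDI.
  have -> : lebesgue_measure (U `&` N) = 0%E.
    by apply: (subset_measure0 _ mN _ N0) => //; exact: measurableI.
  by rewrite adde0.
(* The intervals are listed from left to right and end by [t], so that an interval starting at [t]
   can be appended without overlap. *)
pose fam (t : R) n (s u : nat -> R) :=
  [/\ forall i, (i < n)%N -> [/\ a <= s i, s i <= u i & u i <= t],
      forall i j, (i < j < n)%N -> u i <= s j &
      forall i, (i < n)%N -> `]s i, u i[ `<=` U].
pose T := [set t | a <= t <= b /\ exists n s u, fam t n s u /\
  mdist (beta a) (beta t) <= C * (alpha t - alpha a) + e * (t - a) +
    \sum_(i < n) mdist (beta (s i)) (beta (u i))].
(* Near [c], membership in [T] spreads to the right: with v = c this puts the supremum of [T] into
   [T], with u = c it leads past it. *)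
have step c : a <= c <= b -> exists2 d : R, 0 < d & forall u v,
    a <= u -> u <= v -> v <= b -> u = c \/ v = c -> v - u < d -> T u -> T v.
  move=> acb'.
  (* If [c] is in [U], the interval ]u, v[ joins the family and accounts for the increment of
     [beta]; otherwise the local bound at [c] does. *)
  have [Uc|nUc] := pselect (U c).
    have [d /= d0 dU] :=
      proj1 (@nbhs_ballP _ _ (c : R) _) (open_nbhs_nbhs (conj oU Uc)).
    exists d => // u v au uv vb uvc vud [_ [n [s [w [[f1 f2 f3] H]]]]].
    split; first by rewrite (le_trans au).
    exists n.+1, (fun i => if (i < n)%N then s i else u),
      (fun i => if (i < n)%N then w i else v); split.
      split.
      - move=> i; rewrite ltnS leq_eqVlt => /orP[/eqP->|ni].
          by rewrite ltnn.
        by rewrite ni; have [? ? ?] := f1 _ ni; split => //; exact: le_trans uv.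
      - move=> i j /andP[ij]; rewrite ltnS leq_eqVlt => /orP[/eqP jn|jn].
          by rewrite -jn ij ltnn; subst j; have [] := f1 _ ij.
        by rewrite jn (ltn_trans ij jn); apply: f2; rewrite ij.
      - move=> i; rewrite ltnS leq_eqVlt => /orP[/eqP->|ni]; last first.
          by rewrite ni; exact: f3.
        rewrite ltnn => x /=; rewrite in_itv/= => /andP[ux xv]; apply: dU.
        by rewrite /ball/= ltr_norml; case: uvc => <-; apply/andP; split; lra.
    rewrite big_ord_recr/= ltnn.
    under eq_bigr do rewrite ltn_ord.
    apply: le_trans (metric_triangle _ (beta u) _) _.
    have : C * (alpha u - alpha a) <= C * (alpha v - alpha a).
      rewrite ler_wpM2l// lerD2r alphaP// in_itv/= ?au ?(le_trans au)//.
      by rewrite (le_trans uv).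
    have : e * (u - a) <= e * (v - a).
      by rewrite ler_wpM2l ?(ltW e_gt0)// lerD2r.
    by move: H; lra.
  have gc : forall e : R, 0 < e ->
      exists2 d : R, 0 < d & forall s, `|s - c| < d ->
      mdist (beta s) (beta c) <= C * `|alpha s - alpha c| + e * `|s - c|.
    apply: contrapT => H; apply: nUc; apply: NU; apply: subN => /= H'; apply: H.
    by apply: H'; rewrite in_itv.
  have [d d0 Hd] := gc _ e_gt0.
  exists d => // u v au uv vb uvc vud [_ [n [s [w [[f1 f2 f3] H]]]]].
  split; first by rewrite (le_trans au).
  exists n, s, w; split.
    by split => // i /f1[? ? ?]; split => //; exact: le_trans uv.
  have auv : alpha u <= alpha v.
    by rewrite alphaP// in_itv/= ?au ?(le_trans au)//; rewrite (le_trans uv).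
  have : mdist (beta u) (beta v) <= C * (alpha v - alpha u) + e * (v - u).
    case: uvc => uvc; subst c.
      rewrite metric_sym; have := Hd v.
      by rewrite !ger0_norm ?subr_ge0//; exact.
    have := Hd u; rewrite distrC (distrC (alpha u)).
    by rewrite !ger0_norm ?subr_ge0//; exact.
  have := metric_triangle (beta a) (beta u) (beta v).
  by move: H; lra.
have Ta : T a.
  split; first by rewrite lexx.
  exists 0%N, (fun=> 0), (fun=> 0); split.
    by split=> // i j; rewrite ltn0 andbF.
  by rewrite big_ord0 mdistxx !subrr !mulr0 !addr0.
have supT : has_sup T by split; [exists a|exists b => t [/andP[]]].
pose c := sup T.
have ac : a <= c by apply: ub_le_sup => //; exact: supT.2.
have cb : c <= b by apply: ge_sup => [|t [/andP[]]//]; exists a.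
have [|d d0 Hd] := step c; first by rewrite ac.
have Tc : T c.
  have [u Tu cu] := sup_adherent d0 supT.
  have uc : u <= c by apply: ub_le_sup => //; exact: supT.2.
  have [/andP[au _] _] := Tu.
  by apply: Hd Tu => //; [right|rewrite ltrBlDr addrC -ltrBlDr].
have {Tc} [_ [n [s [u [[f1 f2 f3] H]]]]] : T b.
  have [<-//|cb'] := eqVneq c b.
  have {}cb' : c < b by rewrite lt_neqAle cb'.
  have cv : c < Num.min b (c + d / 2) by rewrite lt_min cb' ltrDl divr_gt0.
  have /(ub_le_sup supT.2) : T (Num.min b (c + d / 2)).
    apply: Hd Tc => //; [exact: ltW|by rewrite ge_min lexx|by left|].
    rewrite ltrBlDl gt_min ltrD2l; apply/orP; right; lra.
  by rewrite leNgt cv.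
(* Padding with the empty set gives a disjoint sequence of measurable sets inside [U], so the total
   length is at most the measure of [U]. *)
pose F (i : nat) : set R := if (i < n)%N then `]s i, u i[%classic else set0.
have tF : trivIset setT F.
  move=> i j _ _ [x []]; rewrite /F.
  case: ifP => // i_n; case: ifP => // jn /=; rewrite !in_itv/=.
  move=> /andP[six xui] /andP[sjx xuj].
  case: (ltngtP i j) => // ij.
    have uisj : u i <= s j by apply: f2; rewrite ij.
    by have := lt_trans xui (le_lt_trans uisj sjx); rewrite ltxx.
  have ujsi : u j <= s i by apply: f2; rewrite ij.
  by have := lt_trans xuj (le_lt_trans ujsi six); rewrite ltxx.
have mF i : measurable (F i) by rewrite /F; case: ifP.
have sumdel : \sum_(i < n) (u i - s i) < del.
  rewrite -lte_fin; apply: le_lt_trans muU.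
  apply: (@le_trans _ _ (lebesgue_measure (\big[setU/set0]_(i < n) F i))).
    have -> : lebesgue_measure (\big[setU/set0]_(i < n) F i) =
        (\sum_(i < n) lebesgue_measure (F i))%E by exact: measure_bigsetU.
    rewrite -sumEFin; apply: lee_sum => i _.
    rewrite /F ltn_ord lebesgue_measure_itv/= lte_fin.
    have [_ si _] := f1 i (ltn_ord i).
    case: ltP => // us; rewrite lee_fin; lra.
  apply: le_measure; rewrite ?inE//.
    by apply: bigsetU_measurable => i _; exact: mF.
  rewrite -bigcup_mkord => x [i /= ni].
  by rewrite /F ni; exact: f3.
have := acdel n (fun i => s i) (fun i => u i).
have tF' : trivIset setT (fun i : 'I_n => `]s i, u i[%classic).
  move=> i j _ _ ij; apply: val_inj; apply: tF => //.
  by rewrite /F !ltn_ord.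
have f1' (i : 'I_n) : a <= s i /\ s i <= u i /\ u i <= b.
  by have [] := f1 i (ltn_ord i).
move=> /(_ f1' tF' sumdel).
have : e * (b - a) <= e0 / 2.
  rewrite /e -mulrA -[leRHS]mulr1 ler_wpM2l ?(ltW e02)// ler_pdivrMl// mulr1.
  by rewrite lerDl.
by move: H; lra.
Qed.

(** As [alpha] is increasing, it stays between [p.1] and [q.1], where f >= m. Hence the local bound
    with constant 1/m holds wherever the curve is causal, that is, almost everywhere. *)
Lemma future_causal_curve_mdist_le (I : set R) (f : R -> R) (m : R)
    (p q : R * X) (a b : R) (alpha : R -> R) (beta : R -> X) :
  future_causal_curve I f p q a b alpha beta -> 0 < m ->
  (forall t, p.1 <= t <= q.1 -> m <= f t) ->
  mdist p.2 q.2 <= m^-1 * (q.1 - p.1).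
Proof.
move=> [ab [<- <-] _ alpha_lt [_ acb causal]] m0 mf /=.
have alpha_le : {in `[a, b] &, {homo alpha : s t / s <= t}}.
  move=> s t sab tab; rewrite le_eqVlt => /predU1P[->//|st].
  by apply: ltW; exact: alpha_lt.
apply: mdist_le_of_local_lipschitz => //; [exact: ltW|by rewrite invr_ge0 ltW|].
have [N [mN N0 subN]] := causal; exists N; split => //.
apply: subset_trans subN; apply: subsetC => t /= {}causal tab e e0.
apply: (causal_at_local_lipschitz (causal tab)) => //; apply: mf => /=.
move: (tab); rewrite in_itv/= => /andP[at_ tb].
by rewrite !alpha_le// in_itv/= lexx ltW.
Qed.

End causal_curves.

(** * Comparison and separation of cover infima *)

Section cover_ext_compare.
Local Open Scope ereal_scope.
Context {R : realType} {T : Type} (w : set T -> \bar R).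
Hypotheses (w0 : w set0 = 0) (w_ge0 : forall A, 0 <= w A).

(** Emptying the members of a cover of [A] that miss [A] keeps it a cover and does not increase its
    weight. *)
Let meeting (A B : set T) : set T := if `[< B `&` A !=set0 >] then B else set0.

Let meeting_cover (A : set T) (F : nat -> set T) :
  A `<=` \bigcup_i F i -> A `<=` \bigcup_i meeting A (F i).
Proof.
move=> AF x Ax; have [i _ Fx] := AF x Ax; exists i => //.
by rewrite /meeting; case: asboolP => //; case; exists x.
Qed.

Let le_meeting (A B : set T) : w (meeting A B) <= w B.
Proof. by rewrite /meeting; case: asboolP => // _; rewrite w0. Qed.

(** This makes size estimates usable that hold only for cover members close to [A]. *)
Lemma le_cover_ext_meeting (C C' : set (set T)) (A : set T) :
  C set0 -> (forall B, C' B -> B `&` A !=set0 -> C B) ->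
  cover_ext C w A <= cover_ext C' w A.
Proof.
move=> C0 CC'; apply: le_ereal_inf_tmp => _ [F [CF AF] <-].
apply: (@le_trans _ _ (\sum_(0 <= i <oo) w (meeting A (F i)))).
  apply: ereal_inf_lbound; exists (meeting A \o F) => //; split => [i|] /=.
    by rewrite /meeting; case: asboolP => // ?; exact: CC'.
  exact: meeting_cover.
exact: lee_nneseries.
Qed.

(** When a cover of the union is split, each weight is counted at most once, as no member meets both
    sets. *)
Lemma cover_ext_separated (C : set (set T)) (A1 A2 : set T) : C set0 ->
  (forall B, C B -> B `&` A1 !=set0 -> B `&` A2 !=set0 -> False) ->
  cover_ext C w A1 + cover_ext C w A2 <= cover_ext C w (A1 `|` A2).
Proof.
move=> C0 sepC; apply: le_ereal_inf_tmp => _ [F [CF AF] <-].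
have leF (A : set T) : A `<=` \bigcup_i F i ->
    cover_ext C w A <= \sum_(0 <= i <oo) w (meeting A (F i)).
  move=> AF'; apply: ereal_inf_lbound; exists (meeting A \o F) => //.
  split => [i|] /=; last exact: meeting_cover.
  by rewrite /meeting; case: asboolP.
apply: (@le_trans _ _ (\sum_(0 <= i <oo)
    (w (meeting A1 (F i)) + w (meeting A2 (F i))))).
  rewrite nneseriesD//.
  by apply: leeD; apply: leF => x Ax; apply: AF; [left|right].
apply: lee_nneseries => [i _ _|i _]; first exact: adde_ge0.
have [FA1|nFA1] := pselect (F i `&` A1 !=set0).
  rewrite {2}/meeting; case: asboolP => [FA2|_]; last by rewrite w0 adde0.
  by case: (sepC _ (CF i)).
rewrite {1}/meeting; case: asboolP => // _; rewrite w0 add0e.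
exact: le_meeting.
Qed.

End cover_ext_compare.

(** The conclusion provides a packaged outer measure, so that the Caratheodory lemmas apply to the
    supremum. *)
Lemma sup_outer_measure {R : realType} {T : Type} (phi : R -> set T -> \bar R) :
  (forall d, phi d set0 = 0%E) -> (forall d A, (0 <= phi d A)%E) ->
  (forall d A B, A `<=` B -> (phi d A <= phi d B)%E) ->
  (forall d, sigma_subadditive (phi d)) ->
  exists mu : {outer_measure set T -> \bar R},
    forall A, mu A = ereal_sup [set phi d A | d in [set d : R | 0 < d]].
Proof.
move=> phi0 phi_ge0 phi_le phi_sub.
pose mu A := ereal_sup [set phi d A | d in [set d : R | 0 < d]].
have le_mu d A : 0 < d -> (phi d A <= mu A)%E.
  by move=> d0; apply: ereal_sup_ubound; exists d.
have mu0 : mu set0 = 0%E.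
  apply/eqP; rewrite eq_le -{2}(phi0 1) le_mu// andbT.
  by apply: ge_ereal_sup => _ [d _ <-]; rewrite phi0.
have mu_ge0 A : (0 <= mu A)%E by exact: le_trans (phi_ge0 1 A) (le_mu _ _ _).
have mu_le : {homo mu : A B / A `<=` B >-> (A <= B)%E}.
  move=> A B AB; apply: ge_ereal_sup => _ [d d0 <-].
  exact: le_trans (phi_le d _ _ AB) (le_mu _ _ d0).
have mu_sub : sigma_subadditive mu.
  move=> F; apply: ge_ereal_sup => _ [d d0 <-].
  apply: le_trans (phi_sub d F) _; apply: lee_nneseries => // i _.
  exact: le_mu.
pose m := isOuterMeasure.Build R T mu mu0 mu_ge0 mu_le mu_sub.
pose mu' : {outer_measure set T -> \bar R} := HB.pack mu m.
by exists mu'.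
Qed.

Lemma Borel_measure_caratheodory {R : realType} {X : metricType R} (I : set R)
    (mu : {outer_measure set (R * X) -> \bar R}) :
  (forall A, Borel I A -> mu.-caratheodory A) -> Borel_measure I mu.
Proof.
move=> muB; split; first exact: outer_measure0.
  by move=> *; exact: outer_measure_ge0.
move=> F BF tF; apply/eqP.
rewrite eq_le outer_measure_sigma_subadditive andTb.
(* The union itself is the test set: its part outside the union is empty. *)
have := caratheodory_lime_le (fun n => muB _ (BF n)) tF (\bigcup_i F i).
rewrite setICr outer_measure0 adde0.
under eq_eseriesr do rewrite (setIidr (bigcup_sup _))//.
exact.
Qed.

(** * The two measures of the warped product *)

Section warped_product_measures.
Context {R : realType} {X : metricType R} (I : set R) (f : R -> R) (w0 N : R).
Implicit Types p q z : R * X.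

(* Equivalent to [wdist], with a simpler triangle inequality. *)
Let sdist p q := `|p.1 - q.1| + mdist p.2 q.2.

Let sdist_triangle q p z : sdist p z <= sdist p q + sdist q z.
Proof. by rewrite addrACA lerD ?ler_distD ?metric_triangle. Qed.

Lemma ler_norm_wdist p q : `|p.1 - q.1| <= wdist p q.
Proof.
by rewrite -[leLHS]normr_id -sqrtr_sqr ler_wsqrtr// lerDl sqr_ge0.
Qed.

Lemma mdist_le_wdist p q : mdist p.2 q.2 <= wdist p q.
Proof.
by rewrite -[leLHS]ger0_norm ?mdist_ge0// -sqrtr_sqr ler_wsqrtr// lerDr sqr_ge0.
Qed.

Lemma wdist_le p q : wdist p q <= `|p.1 - q.1| + mdist p.2 q.2.
Proof.
have s0 : 0 <= `|p.1 - q.1| + mdist p.2 q.2 by rewrite addr_ge0 ?mdist_ge0.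
rewrite -[leRHS]ger0_norm// -sqrtr_sqr ler_wsqrtr// sqrrD.
by rewrite addrAC lerDl mulrn_wge0// mulr_ge0 ?mdist_ge0.
Qed.

Lemma causal_le_warped p q : causal_le I f p q -> warped I p /\ warped I q.
Proof.
case=> [[Ip <-]//|[a [b [alpha [beta [ab [<- <-] Ia _ _]]]]]].
by rewrite /warped/=; split; apply: Ia; rewrite in_itv/= lexx ltW.
Qed.

Lemma causal_le_time p q : causal_le I f p q -> p.1 <= q.1.
Proof.
case=> [[_ ->]//|[a [b [alpha [beta [ab [<- <-] _ alpha_lt _]]]]]].
by rewrite ltW// alpha_lt// in_itv/= lexx ltW.
Qed.

Lemma causal_le_mdist (m : R) p q : 0 < m -> causal_le I f p q ->
  (forall t, p.1 <= t <= q.1 -> m <= f t) ->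
  mdist p.2 q.2 <= m^-1 * (q.1 - p.1).
Proof.
move=> m0 [[_ <-] _|[a [b [alpha [beta pq]]]] mf].
  by rewrite mdistxx subrr mulr0.
exact: future_causal_curve_mdist_le pq m0 mf.
Qed.

Lemma diamond_ends p q : causal_lt I f p q ->
  diamond I f p q p /\ diamond I f p q q.
Proof.
move=> [pq _]; have [Ip Iq] := causal_le_warped pq.
by split; split => //; left.
Qed.

Hypotheses (w0_gt0 : 0 < w0) (N_ge0 : 0 <= N).

(** The integrand of [Gamma] is nonnegative, and a vanishing denominator is harmless as the inverse
    of 0 is 0. *)
Lemma omega_ge0 : 0 <= omega w0 N.
Proof.
rewrite /omega; case: ifPn => _; first exact: ltW.
rewrite divr_ge0 ?powR_ge0// !mulr_ge0 ?powR_ge0//.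
apply: Rintegral_ge0 => t _.
by rewrite mulr_ge0 ?powR_ge0 ?expR_ge0.
Qed.

Lemma rho_ge0 (A : set (R * X)) : (0 <= rho I f w0 N A)%E.
Proof.
apply: le_ereal_inf_tmp => _ [[_ ->]//|[p [q [_ _ ->]]]].
rewrite /weight; case: ifPn => // _.
by rewrite mule_ge0 ?lee_fin ?omega_ge0 ?poweR_ge0.
Qed.

Lemma rho0 : rho (X := X) I f w0 N set0 = 0%E.
Proof.
apply/eqP; rewrite eq_le rho_ge0 andbT.
by apply: ereal_inf_lbound; left.
Qed.

Let CV (d : R) := [set A : set (R * X) |
  diamonds I f A /\ (wdiam A < d%:E)%E].
Let CW (d : R) := [set A : set (R * X) | A = set0 \/ exists p q,
  [/\ causal_lt I f p q, wdist p q < d & A = diamond I f p q]].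

Let CV0 d : CV d set0.
Proof.
split; first by left.
(* The empty set has diameter -oo, which is below every real [d]. *)
rewrite /wdiam (_ : [set _ | _ in _ & _ in _] = set0) ?ereal_sup0 ?ltNyr//.
by apply/seteqP; split => // ? [].
Qed.

Let CW0 d : CW d set0. Proof. by left. Qed.

Lemma Vmeas_outer : exists mu : {outer_measure set (R * X) -> \bar R},
  forall A, mu A = Vmeas I f w0 N A.
Proof.
apply: (sup_outer_measure (phi := fun d => cover_ext (CV d) (rho I f w0 N))).
- by move=> d; apply: cover_ext0 => //; [exact: rho0|exact: rho_ge0].
- by move=> d A; apply: cover_ext_ge0; exact: rho_ge0.
- by move=> d A B; exact: le_cover_ext.
- by move=> d; apply: cover_ext_sigma_subadditive; exact: rho_ge0.
Qed.

Lemma le_Wmeas (A B : set (R * X)) : A `<=` B ->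
  (Wmeas I f w0 N A <= Wmeas I f w0 N B)%E.
Proof.
move=> AB; apply: ge_ereal_sup => _ [d d0 <-].
apply: (@le_trans _ _ (Wdelta I f w0 N d B)); first exact: le_cover_ext.
by apply: ereal_sup_ubound; exists d.
Qed.

Lemma Wmeas_le_Vmeas (A : set (R * X)) :
  (Wmeas I f w0 N A <= Vmeas I f w0 N A)%E.
Proof.
apply: ge_ereal_sup => _ [d d0 <-].
apply: (@le_trans _ _ (Vdelta I f w0 N d A)); last first.
  by apply: ereal_sup_ubound; exists d.
apply: (le_cover_ext_meeting rho0 rho_ge0 (CW0 d)).
move=> B [[->|[p [q [pq ->]]]] Bd] _.
  by left.
right; exists p, q; split => //; rewrite -lte_fin; apply: le_lt_trans Bd.
have [pJ qJ] := diamond_ends pq.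
by apply: ereal_sup_ubound; exists p => //; exists q.
Qed.

(** As [sdist] is at most twice [wdist], a set of diameter less than e/2 cannot meet both [A] and
    [B]. *)
Let Vmeas_separated (e : R) (A B : set (R * X)) : 0 < e ->
  (forall p q, A p -> B q -> e <= sdist p q) ->
  (Vmeas I f w0 N A + Vmeas I f w0 N B <= Vmeas I f w0 N (A `|` B))%E.
Proof.
move=> e0 sepAB.
have anti d d' (C : set (R * X)) : d <= d' ->
    (Vdelta I f w0 N d' C <= Vdelta I f w0 N d C)%E.
  move=> dd'; apply: (le_cover_ext_meeting rho0 rho_ge0 (CV0 d')).
  by move=> D [JD Dd] _; split => //; apply: lt_le_trans Dd _; rewrite lee_fin.
have sep d : 0 < d -> d <= e / 2 ->
    (Vdelta I f w0 N d A + Vdelta I f w0 N d B <= Vmeas I f w0 N (A `|` B))%E.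
  move=> d0 de.
  apply: (@le_trans _ _ (Vdelta I f w0 N d (A `|` B))); last first.
    by apply: ereal_sup_ubound; exists d.
  apply: (cover_ext_separated rho0 rho_ge0 (CV0 d)).
  move=> D [_ Dd] [p [Dp Ap]] [q [Dq Bq]].
  have : (wdist p q < d).
    rewrite -lte_fin; apply: le_lt_trans Dd.
    by apply: ereal_sup_ubound; exists p => //; exists q.
  have := sepAB _ _ Ap Bq; rewrite /sdist.
  have := ler_norm_wdist p q; have := mdist_le_wdist p q; lra.
(* [Vdelta] is antitone in the scale, so two scales can be replaced by a common smaller one. *)
have sep2 d d' : 0 < d -> 0 < d' ->
    (Vdelta I f w0 N d A + Vdelta I f w0 N d' B <= Vmeas I f w0 N (A `|` B))%E.
  move=> d0 d'0; pose d2 := Num.min (Num.min d d') (e / 2).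
  have d20 : 0 < d2 by rewrite !lt_min d0 d'0 divr_gt0.
  apply: le_trans (sep d2 d20 _); last by rewrite ge_min lexx orbT.
  by apply: leeD; apply: anti; rewrite !ge_min lexx ?orbT.
(* The two suprema are taken one after the other; finiteness allows moving terms across the
   inequality. *)
have [->|Voo] := eqVneq (Vmeas I f w0 N (A `|` B)) +oo%E; first exact: leey.
have V_ge0 d (C : set (R * X)) : (0 <= Vdelta I f w0 N d C)%E.
  by apply: cover_ext_ge0; exact: rho_ge0.
have BAB d : 0 < d -> Vdelta I f w0 N d B \is a fin_num.
  move=> d0; rewrite ge0_fin_numE//.
  apply: le_lt_trans (_ : Vmeas I f w0 N (A `|` B) < +oo)%E;
    last by rewrite ltey.
  apply: le_trans (sep2 1 d ltr01 d0); exact: leeDr.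
have VAfin : Vmeas I f w0 N A \is a fin_num.
  rewrite ge0_fin_numE; last first.
    by apply: le_trans (V_ge0 1 A) _; apply: ereal_sup_ubound; exists 1 => /=.
  apply: le_lt_trans (_ : Vmeas I f w0 N (A `|` B) < +oo)%E;
    last by rewrite ltey.
  apply: ge_ereal_sup => _ [d d0 <-].
  apply: le_trans (sep2 d 1 d0 ltr01); exact: leeDl.
rewrite -leeBrDl//; apply: ge_ereal_sup => _ [d d0 <-].
rewrite leeBrDl// -leeBrDr ?BAB//; apply: ge_ereal_sup => _ [d' d'0 <-].
by rewrite leeBrDr ?BAB//; exact: sep2.
Qed.

Let Vmeas_caratheodory (U : set (R * X)) :
  (forall p, U p -> exists2 e : R, 0 < e & forall q, sdist p q < e -> U q) ->
  (Vmeas I f w0 N).-caratheodory U.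
Proof.
have [mu muE] := Vmeas_outer; have <- : mu = Vmeas I f w0 N :> (set _ -> _).
  exact/funext.
move=> oU; apply: metric_outer_caratheodory oU; first exact: sdist_triangle.
by move=> e A B e0 AB; rewrite !muE; exact: Vmeas_separated e0 AB.
Qed.

Lemma Vmeas_Borel_caratheodory (A : set (R * X)) : open I -> Borel I A ->
  (Vmeas I f w0 N).-caratheodory A.
Proof.
move=> openI; move: A.
have oV (U : set (R * X)) : open U -> (Vmeas I f w0 N).-caratheodory U.
  move=> oU; apply: Vmeas_caratheodory => p Up.
  have [e /= e0 eU] :=
    proj1 (@nbhs_ballP _ _ p _) (open_nbhs_nbhs (conj oU Up)).
  exists e => // q pq; apply: eU; split => /=.
    by rewrite /ball/=; apply: le_lt_trans pq; rewrite lerDl mdist_ge0.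
  by rewrite ballEmdist/=; apply: le_lt_trans pq; rewrite lerDr.
(* Complements in [Borel] are relative to [warped I], whose own measurability comes from its
   openness. *)
have oI : open (warped (X := X) I).
  by apply: open_comp => // p _; exact: cvg_fst.
have [mu muE] := Vmeas_outer.
have muV : Vmeas I f w0 N = mu by exact/funext.
rewrite muV in oV *.
apply: smallest_sub; last by move=> U [oU _]; exact: oV.
split.
- exact: caratheodory_measurable_set0.
- by move=> A mA; apply: caratheodory_measurable_setD => //; exact: oV.
- by move=> F mF; exact: caratheodory_measurable_bigcup.
Qed.

(** The same [r] is a lower bound for [f] and the radius in time on which it holds, so that [M r]
    grows as [r] decreases to 0. *)
Let M (r : R) : set (R * X) :=
  [set p | forall t, `|t - p.1| < r -> I t /\ r <= f t].

Lemma Vmeas_le_Wmeas_local (r : R) (A : set (R * X)) : 0 < r -> A `<=` M r ->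
  (Vmeas I f w0 N A <= Wmeas I f w0 N A)%E.
Proof.
move=> r0 AM; apply: ge_ereal_sup => _ [d /= d0 <-].
have c0 : 0 < 1 + 2 * r^-1 by rewrite ltr_wpDr// mulr_ge0// invr_ge0 ltW.
(* The bound by [r] keeps diamonds meeting [A] where f >= r. The other one bounds their diameter by
   d/2, hence strictly by [d]: 1 is for time and 2/r for space, through [p]. *)
pose d' := Num.min r (d / 2 / (1 + 2 * r^-1)).
have d'0 : 0 < d' by rewrite lt_min r0 !divr_gt0.
have d'r : d' <= r by rewrite ge_min lexx.
have d'd : (1 + 2 * r^-1) * d' < d.
  apply: (@le_lt_trans _ _ (d / 2)); last by lra.
  by rewrite mulrC -ler_pdivlMr// ge_min lexx orbT.
apply: (@le_trans _ _ (Wdelta I f w0 N d' A)); last first.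
  by apply: ereal_sup_ubound; exists d'.
apply: (le_cover_ext_meeting rho0 rho_ge0 (CV0 d)).
move=> B [->|[p [q [pq pqd ->]]]] [z [Bz Az]]; first exact: CV0.
have [pz zq] := Bz.
split; first by right; exists p, q.
have pqd' : q.1 - p.1 < d'.
  apply: le_lt_trans pqd; apply: le_trans (ler_norm_wdist _ _).
  by rewrite distrC ler_norm.
(* Both [t] and [z.1] lie in [p.1, q.1], which is shorter than [r], and [z] is in [M r]. *)
have rf t : p.1 <= t <= q.1 -> r <= f t.
  move=> /andP[pt tq].
  apply: (proj2 (AM _ Az t _)).
  have := causal_le_time pz; have := causal_le_time zq.
  by move=> zq1 pz1; rewrite ltr_norml; apply/andP; split; lra.
have close y : diamond I f p q y ->
    [/\ p.1 <= y.1, y.1 <= q.1 & mdist p.2 y.2 <= r^-1 * d'].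
  move=> [py yq]; have py1 := causal_le_time py; have yq1 := causal_le_time yq.
  split => //; apply: (@le_trans _ _ (r^-1 * (y.1 - p.1))).
    apply: causal_le_mdist => // t /andP[pt ty].
    by apply: rf; rewrite pt (le_trans ty).
  by rewrite ler_wpM2l ?invr_ge0 ?(ltW r0)//; lra.
apply: (@le_lt_trans _ _ ((1 + 2 * r^-1) * d')%:E); last by rewrite lte_fin.
apply: ge_ereal_sup => _ [y Jy [y' Jy' <-]]; rewrite lee_fin.
apply: le_trans (wdist_le _ _) _.
have [py yq dy] := close _ Jy; have [py' yq' dy'] := close _ Jy'.
have yy' : `|y.1 - y'.1| <= d' by rewrite ler_norml; apply/andP; split; lra.
have := metric_triangle y.2 p.2 y'.2; rewrite (metric_sym y.2 p.2).
by move: dy dy' yy'; lra.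
Qed.

Lemma Vmeas_le_Wmeas (A : set (R * X)) :
  open I -> {within I, continuous f} -> (forall t, I t -> 0 < f t) ->
  A `<=` warped I -> (Vmeas I f w0 N A <= Wmeas I f w0 N A)%E.
Proof.
move=> openI fcont fpos AI.
pose r n : R := n.+1%:R^-1.
have r0 n : 0 < r n by rewrite invr_gt0.
have leM : {homo M \o r : m n / (m <= n)%N >-> (m <= n)%O}.
  move=> m n mn; apply/subsetPset => p Mp t tp.
  have rnm : r n <= r m by rewrite lef_pV2 ?posrE// ler_nat.
  have [It rf] := Mp t (lt_le_trans tp rnm).
  by split => //; exact: le_trans rf.
have warpedM : warped I `<=` \bigcup_n M (r n).
  move=> p Ip; have fp0 : 0 < f p.1 / 2 by rewrite divr_gt0// fpos.
  have cf : {for p.1, continuous f}.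
    move: fcont; rewrite continuous_open_subspace//; apply.
    by rewrite inE.
  have near_f : \forall t \near p.1, f p.1 / 2 < f t.
    have f2 : f p.1 / 2 < f p.1 by move: fp0; lra.
    exact: (cvgr_gt (f p.1) cf).
  have near_I : \forall t \near p.1, I t by exact: open_nbhs_nbhs.
  have [e /= e0 He] := proj1 (@nbhs_ballP _ _ p.1 _) (filterI near_f near_I).
  (* 1/(n+1) has to be below both the radius [e] and the lower bound of [f] on that neighborhood. *)
  have [|n] := @ltr_add_invr _ 0 (Num.min e (f p.1 / 2)).
    by rewrite lt_min e0.
  rewrite add0r lt_min => /andP[ne nf]; exists n => // t tp.
  have [|ft It] := He t; first by rewrite /ball/= distrC (lt_trans tp).
  by split => //; rewrite ltW// (lt_trans nf).
have [mu muE] := Vmeas_outer.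
have muV : Vmeas I f w0 N = mu by exact/funext.
have cM n : mu.-caratheodory (M (r n)).
  (* The complement of [M (r n)] is open for [sdist]: a time [t] that violates the condition at [p]
     still does at [q] while [sdist p q] is below the margin chosen. *)
  rewrite -[M _]setCK; apply: caratheodory_measurable_setC.
  rewrite -muV; apply: Vmeas_caratheodory => p /existsNP[t /not_implyP[tp nt]].
  exists (r n - `|t - p.1|); first by rewrite subr_gt0.
  move=> q pq /(_ t) H; apply: nt; apply: H.
  apply: le_lt_trans (ler_distD p.1 _ _) _; rewrite -ltrBrDl.
  by apply: le_lt_trans pq; rewrite lerDl mdist_ge0.
pose D := seqD (M \o r).
have cD n : mu.-caratheodory (D n).
  case: n => [|n]; first exact: cM 0%N.
  exact: caratheodory_measurable_setD (cM n.+1) (cM n).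
have DM k : D k `<=` M (r k) by case: k => [|k] //; exact: subDsetl.
have tD : trivIset setT D by exact: trivIset_seqD.
have AD : A `&` \bigcup_n D n = A.
  rewrite /D eq_bigcup_seqD; apply/setIidPl; exact: subset_trans warpedM.
(* Over the disjoint layers [D], additivity recombines each partial sum into the measure of a part
   of [A] inside [M (r n)], where the local bound applies. *)
rewrite muV -{1}AD; apply: le_trans (outer_measure_bigcup_lim mu D A) _.
apply: lime_le; first by apply: is_cvg_nneseries => *; exact: outer_measure_ge0.
apply: nearW => n /=; rewrite big_mkord -caratheodory_additive//.
apply: (@le_trans _ _ (mu (A `&` M (r n)))).
  apply: le_outer_measure; apply: setIS.
  rewrite -bigcup_mkord => p [k /= kn Dp].
  by have /subsetPset := leM _ _ (ltnW kn); apply; exact: DM Dp.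
rewrite muE; apply: (@le_trans _ _ (Wmeas I f w0 N (A `&` M (r n)))).
  by apply: Vmeas_le_Wmeas_local (r0 n) _ => p [].
by apply: le_Wmeas => p [].
Qed.

End warped_product_measures.

Theorem theorem4p20 (R : realType) (X : metricType R) (I : set R) (f : R -> R)
    (w0 N : R)
    (openI : open I) (itvI : is_interval I) (I_neq0 : I !=set0)
    (properX : proper_space X) (lengthX : length_space X)
    (geodesicX : geodesic_space X)
    (fcont : {within I, continuous f}) (fpos : forall t, I t -> 0 < f t)
    (w0_gt0 : 0 < w0) (N_ge0 : 0 <= N) :
  [/\ Borel_measure I (Vmeas (X:=X) I f w0 N),
      Borel_measure I (Wmeas (X:=X) I f w0 N) &
      forall A : set (R * X), Borel I A ->
        Wmeas I f w0 N A = Vmeas I f w0 N A].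
Proof.
have sigmaB : sigma_algebra (warped (X := X) I) (Borel (X := X) I).
  exact: smallest_sigma_algebra.
have [B0 _ BU] := sigmaB.
(* The generators lie in [warped I], and relative complements and unions stay there. *)
have BI : Borel I `<=` [set A : set (R * X) | A `<=` warped I].
  apply: smallest_sub; last by move=> U [].
  split=> [|A _|F FI]; [exact: sub0set|exact: subDsetl|].
  by move=> p [i _ Fp]; exact: FI Fp.
have WV (A : set (R * X)) : Borel I A -> Wmeas I f w0 N A = Vmeas I f w0 N A.
  move=> BA; apply/eqP; rewrite eq_le Wmeas_le_Vmeas//=.
  by apply: Vmeas_le_Wmeas => //; exact: BI.
have BV : Borel_measure I (Vmeas (X := X) I f w0 N).
  have [mu muE] := @Vmeas_outer R X I f w0 N w0_gt0 N_ge0.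
  have muV : Vmeas I f w0 N = mu by exact/funext.
  rewrite muV; apply: Borel_measure_caratheodory => A BA; rewrite -muV.
  exact: Vmeas_Borel_caratheodory.
split => //; have [V0 V_ge0 Vadd] := BV; split => [|A BA|F BF tF].
- by rewrite WV.
- by rewrite WV//; exact: V_ge0.
- rewrite WV ?Vadd//; last exact: BU.
  by apply: eq_eseriesr => i _; rewrite WV.
Qed.
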